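(* Let $X$ be a geodesic metric space with a bounded $(\lambda_0,\kappa_0)$-quasi-geodesic combing. For every quasi-geodesic pair of constants $(\lambda,\kappa)$ and every $\mu\ge0$, there exist a scale $D\ge0$ and quasi-geodesic constants $(\lambda',\kappa')$ such that every path $\mathfrak p$ that $D$-locally is a $(2\lambda_0+2,\kappa_0,\mu)$-weakly Morse $(\lambda,\kappa)$-quasi-geodesic is a global $(\lambda',\kappa')$-quasi-geodesic.
   Context: A $(\lambda,\kappa)$-quasi-geodesic ($\lambda\ge1,\kappa\ge0$) is a map $\gamma:I\to X$, $I\subseteq\mathbb R$ a closed interval, with $\frac1\lambda|s-t|-\kappa\le d(\gamma(s),\gamma(t))\le\lambda|s-t|+\kappa$ for all $s,t\in I$. Convention: all quasi-geodesics are assumed improved, i.e. continuous and such that the arc length of $\gamma|_{[t,t']}$ is at most $k_1 d(\gamma(t),\gamma(t'))+k_2$ for all $t,t'$, where $k_1=\lambda(\lambda+\kappa)$, $k_2=(\lambda\kappa'+3)(\lambda+\kappa)$, $\kappa'=2(\lambda+\kappa)$ (in a geodesic space every quasi-geodesic is approximated by such a one). A path is a continuous map from an interval to $X$. $\mathcal N_r(Y)$ is the closed $r$-neighbourhood of $Y$. Bounded combing: a $(\lambda_0,\kappa_0)$-quasi-geodesic combing assigns to every ordered pair $(x,y)\in X\times X$ a $(\lambda_0,\kappa_0)$-quasi-geodesic $\mathfrak q_{xy}:[0,T_{xy}]\to X$ from $x$ to $y$ (extended to $\mathbb R$ by constant maps). It is bounded if $d(\mathfrak q_{xy_1}(t),\mathfrak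 q_{xy_2}(t))\le\kappa_0 d(y_1,y_2)+\kappa_0$ for all $t\in\mathbb R$ and $x,y_1,y_2\in X$. Weakly Morse: a quasi-geodesic $\gamma$ is $(Q,q,\mu)$-weakly Morse if every $(Q,q)$-quasi-geodesic $\eta$ with endpoints $\gamma(s),\gamma(t)$ satisfies $\eta\subseteq\mathcal N_\mu(\gamma|_{[s,t]})$. A path $\mathfrak p$ $D$-locally has property (P) if every restriction $\mathfrak p|_{[t_1,t_2]}$ with $|t_1-t_2|\le D$ has (P). *)

(* Defs.v *)
From HB Require Import structures.
From mathcomp Require Import all_boot all_order all_algebra.
From mathcomp Require Import all_classical all_reals all_analysis.

Set Implicit Arguments.
Unset Strict Implicit.
Unset Printing Implicit Defensive.

Import Order.TTheory GRing.Theory Num.Theory.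
Import numFieldNormedType.Exports.

Local Open Scope classical_set_scope.
Local Open Scope ring_scope.

Section Defs.
Context {R : realType} {X : metricType R}.
Implicit Types (lambda kappa mu : R) (I : interval R) (gamma : R -> X).

(* A map defined on an interval I is a total function R -> X of which only the
   values on I matter. *)

Definition geodesic_space : Prop :=
  forall x y : X, exists gamma : R -> X,
    [/\ gamma 0 = x, gamma (mdist x y) = y &
      {in `[0, mdist x y] &, forall s t, mdist (gamma s) (gamma t) = `|s - t|}].

(* For a <= b: supremum of the lengths of the inscribed polygons, indexed by the
   subdivisions a < s_1 < ... < s_n = b (n = 0 when a = b). *)
Definition arc_length (a b : R) gamma : \bar R :=
  ereal_sup [set (\sum_(0 <= i < size s)
      mdist (gamma (nth b (a :: s) i)) (gamma (nth b (a :: s) i.+1)))%:E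
    | s in itv_partition a b].

Definition improved_k1 lambda kappa : R := lambda * (lambda + kappa).

Definition improved_k2 lambda kappa : R :=
  (lambda * (2 * (lambda + kappa)) + 3) * (lambda + kappa).

(* Quasi-geodesics are always the improved (tame) ones.  Intervals that are not
   closed are allowed, so that the notion makes sense for every path; on closed
   intervals this is the usual definition. *)
Definition quasi_geodesic lambda kappa I gamma : Prop :=
  [/\ {within [set` I], continuous gamma},
      {in I &, forall s t,
        lambda^-1 * `|s - t| - kappa <= mdist (gamma s) (gamma t)
          <= lambda * `|s - t| + kappa} &
      {in I &, forall t t', t <= t' ->
        (arc_length t t' gamma <=
          (improved_k1 lambda kappa * mdist (gamma t) (gamma t')
            + improved_k2 lambda kappa)%:E)%E}].

Definition closed_neighbourhood (r : R) (Y : set X) : set X :=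
  [set x | (ereal_inf [set (mdist x y)%:E | y in Y] <= r%:E)%E].

Definition weakly_morse (Q q mu : R) I gamma : Prop :=
  {in I &, forall s t, s <= t ->
    forall (a b : R) (eta : R -> X), a <= b ->
      quasi_geodesic Q q `[a, b] eta -> eta a = gamma s -> eta b = gamma t ->
      eta @` `[a, b] `<=` closed_neighbourhood mu (gamma @` `[s, t])}.

Definition locally_on (D : R) (P : interval R -> (R -> X) -> Prop) I gamma :
    Prop :=
  {in I &, forall t1 t2, t1 <= t2 -> `|t1 - t2| <= D -> P `[t1, t2] gamma}.

Definition is_path I gamma : Prop := {within [set` I], continuous gamma}.

(* cq x y restricted to [0, T x y] is the combing line from x to y. *)
Definition quasi_geodesic_combing lambda0 kappa0
    (T : X -> X -> R) (cq : X -> X -> R -> X) : Prop :=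
  forall x y,
    [/\ 0 <= T x y,
        quasi_geodesic lambda0 kappa0 `[0, T x y] (cq x y),
        forall t, t <= 0 -> cq x y t = x &
        forall t, T x y <= t -> cq x y t = y].

Definition bounded_combing kappa0 (cq : X -> X -> R -> X) : Prop :=
  forall (t : R) (x y1 y2 : X),
    mdist (cq x y1 t) (cq x y2 t) <= kappa0 * mdist y1 y2 + kappa0.

End Defs.

Arguments geodesic_space {R} X.

(* Main.v *)
Require Import Defs.
From mathcomp Require Import all_boot all_order all_algebra.
From mathcomp Require Import all_classical all_reals all_analysis.
From mathcomp Require Import ring lra.

Import Order.TTheory GRing.Theory Num.Theory.
Import numFieldNormedType.Exports.

Local Open Scope classical_set_scope.
Local Open Scope ring_scope.

(* Fix a start point p(s0) and follow the combing lines q_t from p(s0) to p(t).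
   The whole of p|[s0,t] stays within a constant A of q_t, by induction on t in
   unit steps: boundedness of the combing turns the bound A for q_t' into a
   worse bound B for q_t, t - t' <= 1.  To get back to A at p(u), join p(u-L) and
   p(u+L) to closest points of q_t; with the piece of q_t in between this is a
   (2 lambda0 + 2, kappa0)-quasi-geodesic, so by the local weak Morse property
   that piece of q_t is mu-close to p|[u-L,u+L], and walking along it yields a
   point close to p(u), with a constant independent of B.
   The same statement shows that closest parameters on q_t of the points
   p(s0 + i L) increase by a definite amount at each step: p(s0 + i L) is close
   to the piece of q_t between its neighbours' parameters.  Hence the length of
   q_t, and so d(p(s0), p(t)), grows linearly in t - s0. *)

(** * Lengths of curves *)

Section Curves.
Context {R : realType} {X : metricType R}.
Implicit Types (c : R -> X) (l : seq R).

Fixpoint polygon_length c (x : R) l : R :=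
  if l is y :: l' then mdist (c x) (c y) + polygon_length c y l' else 0.

(* Subdivisions with repeated points and not reaching [b] are admitted: this
   makes splitting, reversing and restricting subdivisions immediate. *)
Definition length_le c (a b M : R) : Prop :=
  forall l, path <=%R a l -> last a l <= b -> polygon_length c a l <= M.

Lemma polygon_length_sum c x d l :
  polygon_length c x l =
  \sum_(0 <= i < size l) mdist (c (nth d (x :: l) i)) (c (nth d (x :: l) i.+1)).
Proof.
elim: l x => [|y l IH] x /=; first by rewrite big_nil.
by rewrite big_nat_recl //= IH.
Qed.

Lemma polygon_length_cat c x l1 l2 :
  polygon_length c x (l1 ++ l2) =
  polygon_length c x l1 + polygon_length c (last x l1) l2.
Proof. by elim: l1 x => [|y l1 IH] x /=; rewrite ?add0r // IH addrA. Qed.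

Lemma path_le_last (x : R) l : path <=%R x l -> x <= last x l.
Proof. by elim: l x => //= y l IH x /andP[xy /IH]; apply: le_trans. Qed.

(** Dropping repeated points keeps the length and adding [b] at the end does not decrease it, so
    weak and strict subdivisions give the same supremum. *)
Lemma polygon_length_refine c (a b : R) l :
  a <= b -> path <=%R a l -> last a l <= b ->
  exists2 s, itv_partition a b s & polygon_length c a l <= polygon_length c a s.
Proof.
elim: l a => [|y l IH] a ab /=.
  move=> _ _; case: (eqVneq a b) => [->|nab].
    by exists [::]; rewrite /itv_partition /=.
  exists [:: b]; last by rewrite /= addr0 mdist_ge0.
  by apply: itv_partition1; rewrite lt_neqAle nab.
move=> /andP[ay yl] lb.
have yb : y <= b := le_trans (path_le_last _ _ yl) lb.
have [s sP sl] := IH y yb yl lb.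
move: ay; rewrite le_eqVlt => /predU1P[->|ay].
  by exists s => //; rewrite mdistxx add0r.
exists (y :: s); last by rewrite /= lerD2l.
by case: sP => ? ?; split => //=; rewrite ay.
Qed.

Lemma arc_length_leP c (a b M : R) :
  a <= b -> (arc_length a b c <= M%:E)%E <-> length_le c a b M.
Proof.
move=> ab; split=> [H l al lb|H].
  have [s sP sl] := polygon_length_refine c a b l ab al lb.
  apply: le_trans sl _; rewrite -lee_fin; apply: le_trans H.
  apply: ereal_sup_ubound; exists s => //=.
  by rewrite (polygon_length_sum _ _ b).
apply: ge_ereal_sup => _ [s [ps /eqP lsb] <-].
rewrite lee_fin -polygon_length_sum; apply: H; last by rewrite lsb.
by apply: sub_path ps => x y /ltW.
Qed.

Lemma length_le_mono c (a b M N : R) : M <= N -> length_le c a b M ->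
  length_le c a b N.
Proof. by move=> MN H l al lb; apply: le_trans (H l al lb) MN. Qed.

Lemma length_le_eq c c' (a b M : R) :
  (forall t, a <= t <= b -> c t = c' t) -> length_le c a b M ->
  length_le c' a b M.
Proof.
move=> cc' H l al lb; suff -> : polygon_length c' a l = polygon_length c a l.
  exact: H.
elim: l a {H} al lb cc' => //= y l IH a /andP[ay yl] lb cc'.
have yb : y <= b := le_trans (path_le_last _ _ yl) lb.
rewrite IH// => [|t /andP[yt tb]].
  by rewrite !cc' // ?lexx ?ay ?yb //= (le_trans ay).
by apply: cc'; rewrite tb (le_trans ay).
Qed.

Lemma length_le_cat c (a m b M N : R) : a <= m <= b ->
  length_le c a m M -> length_le c m b N -> length_le c a b (M + N).
Proof.
move=> /andP[am mb] HM HN l.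
(* The bound before [m] is generalised to [M'], from which the edges already passed are subtracted.
   The edge crossing [m] is split there by the triangle inequality. *)
suff H x M' : (x <= m) -> (length_le c x m M') -> path <=%R x l ->
    last x l <= b -> polygon_length c x l <= M' + N by exact: H.
elim: l x M' {M a am HM} => [|y l IH] x M xm HM /=.
  move=> _ _; apply: addr_ge0; first exact: (HM [::]).
  exact: (HN [::]).
move=> /andP[xy yl] lb; case: (leP y m) => [ym|/ltW my].
  rewrite -lerBrDl addrAC; apply: IH => //.
  move=> l' yl' lm; rewrite lerBrDl.
  by apply: (HM (y :: l')) => //=; rewrite xy.
have := HN (y :: l); rewrite /= my => /(_ yl lb) H.
have := HM [:: m]; rewrite /= xm lexx => /(_ isT isT) H'.
have := metric_triangle (c x) (c m) (c y); lra.
Qed.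

Lemma length_le_dist c (a b M : R) :
  a <= b -> length_le c a b M -> mdist (c a) (c b) <= M.
Proof.
by move=> ab /(_ [:: b]); rewrite /= ab lexx addr0 => /(_ isT isT).
Qed.

Lemma length_le_isometry c (a b : R) :
  (forall s t, a <= s -> s <= t -> t <= b -> mdist (c s) (c t) = t - s) ->
  length_le c a b (b - a).
Proof.
move=> iso l; elim: l a iso => [|y l IH] a iso /=; first by rewrite subr_ge0.
move=> /andP[ay yl] lb; have yb := le_trans (path_le_last _ _ yl) lb.
rewrite iso//; have := IH y _ yl lb.
have -> : b - a = y - a + (b - y) by ring.
by rewrite lerD2l; apply=> s t ys; apply: iso; apply: le_trans ys.
Qed.

Lemma length_le_refl c (a : R) : length_le c a a 0.
Proof.
rewrite -(subrr a); apply: length_le_isometry => s t as_ st ta.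
have -> : s = a by lra.
have -> : t = a by lra.
by rewrite mdistxx subrr.
Qed.

Lemma polygon_length_rev c x l :
  polygon_length c (last x l) (rev (belast x l)) = polygon_length c x l.
Proof.
elim: l x => [|y l IH] x //=; rewrite rev_cons -cats1 polygon_length_cat IH /=.
rewrite addr0 addrC; congr (_ + _); rewrite metric_sym.
by case: l {IH} => //= z l; rewrite rev_cons last_rcons.
Qed.

Lemma polygon_length_opp c x l :
  polygon_length (fun t => c (- t)) x l =
  polygon_length c (- x) (map -%R l).
Proof. by elim: l x => //= y l ->. Qed.

Lemma length_le_opp c (a b M : R) :
  length_le c a b M -> length_le (fun t => c (- t)) (- b) (- a) M.
Proof.
move=> H l bl la; rewrite polygon_length_opp -polygon_length_rev.
rewrite last_map; set x := - last _ _.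
have ax : a <= x by rewrite /x lerNr.
set s := rev _.
have xs : path <=%R x s.
  rewrite /x /s -[- last _ _](last_map -%R) rev_path path_map.
  by apply: sub_path bl => u v /=; rewrite lerN2.
have sb : last x s <= b.
  rewrite /s; case: l bl {la xs s} @x ax => [|z l] bl x ax /=.
    by rewrite /x /= lerNl.
  by rewrite rev_cons last_rcons lerNl.
(* The reversed subdivision starts at [x] and not at [a]; prepending the edge from [a] to [x] can
   only lengthen the polygon. *)
have /= := H (x :: s); rewrite ax xs sb => /(_ isT isT).
by apply: le_trans; rewrite lerDr mdist_ge0.
Qed.

(** * Continuity and quasi-geodesics on compact intervals *)

Lemma within_itv_continuousP c (a b : R) :
  {within `[a, b], continuous c} <->
  (forall x, a <= x <= b -> forall e, 0 < e -> exists2 d, 0 < d &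
     forall y, a <= y <= b -> `|x - y| < d -> mdist (c x) (c y) < e).
Proof.
rewrite subspace_continuousP; split=> [H x xab e e0|H x xab].
  have /metricType_numDomainType.cvgrPdist_lt/(_ e e0) := H x xab.
  rewrite near_withinE => /nbhs_ballP[d /= d0 dP]; exists d => // y yab xy.
  by apply: dP.
apply/metricType_numDomainType.cvgrPdist_lt => e e0.
have [d d0 dP] := H x xab e e0.
rewrite near_withinE; apply/nbhs_ballP; exists d => //= y xy yab.
exact: dP.
Qed.

(** Restricting to [s <= t] and clearing the lower bound of [lambda^-1] lets the estimates chain
    without absolute values and inverses. *)
Lemma quasi_geodesicP (lambda kappa a b : R) c : 0 < lambda ->
  quasi_geodesic lambda kappa `[a, b] c <->
  [/\ {within `[a, b], continuous c},
      forall s t, a <= s -> s <= t -> t <= b ->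
        t - s <= lambda * (mdist (c s) (c t) + kappa) /\
        mdist (c s) (c t) <= lambda * (t - s) + kappa &
      forall s t, a <= s -> s <= t -> t <= b ->
        length_le c s t (improved_k1 lambda kappa * mdist (c s) (c t) +
                         improved_k2 lambda kappa)].
Proof.
move=> l0; split=> -[cc H K]; split=> //.
- move=> s t as_ st tb.
  have sI : s \in `[a, b] by rewrite in_itv /= as_ (le_trans st).
  have tI : t \in `[a, b] by rewrite in_itv /= tb andbT (le_trans as_).
  have := H s t sI tI; rewrite distrC ger0_norm ?subr_ge0// => /andP[H1 ->].
  by split=> //; rewrite -ler_pdivrMl// -lerBlDr.
- move=> s t as_ st tb; apply/arc_length_leP => //; apply: K => //.
    by rewrite in_itv /= as_ (le_trans st).
  by rewrite in_itv /= tb andbT (le_trans as_).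
- have main s t : s \in `[a, b] -> t \in `[a, b] -> s <= t ->
     lambda^-1 * `|s - t| - kappa <= mdist (c s) (c t) <=
     lambda * `|s - t| + kappa.
    rewrite !in_itv /= => /andP[as_ _] /andP[_ tb] st.
    have [H1 H2] := H s t as_ st tb.
    rewrite distrC ger0_norm ?subr_ge0// H2 andbT.
    by rewrite lerBlDr ler_pdivrMl.
  move=> s t sI tI; have [st|/ltW ts] := leP s t; first exact: main.
  by rewrite distrC metric_sym; exact: main.
- move=> s t; rewrite !in_itv /= => /andP[as_ _] /andP[_ tb] st.
  by apply/arc_length_leP => //; exact: K.
Qed.

Lemma quasi_geodesic_sub lambda kappa (a b a' b' : R) c :
  a <= a' -> b' <= b -> quasi_geodesic lambda kappa `[a, b] c ->
  quasi_geodesic lambda kappa `[a', b'] c.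
Proof.
move=> aa' bb' [cc H K].
have sub x : x \in `[a', b'] -> x \in `[a, b].
  rewrite !in_itv /= => /andP[/(le_trans aa') -> /= xb].
  exact: le_trans bb'.
split=> [|s t /sub sI /sub tI|s t /sub sI /sub tI].
- by apply: continuous_subspaceW cc => x /= /sub.
- exact: H.
- exact: K.
Qed.

Lemma quasi_geodesic_opp lambda kappa (a b : R) c : 0 < lambda ->
  quasi_geodesic lambda kappa `[a, b] c ->
  quasi_geodesic lambda kappa `[- b, - a] (fun t => c (- t)).
Proof.
move=> l0 /(quasi_geodesicP _ _ _ _ _ l0)[/within_itv_continuousP cc H K].
apply/quasi_geodesicP => //; split.
- apply/within_itv_continuousP => x xab e e0.
  have [|d d0 dP] := cc (- x) _ e e0.
    by move: xab; rewrite lerNr lerNl andbC.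
  exists d => // y yab xy; apply: dP.
    by move: yab; rewrite lerNr lerNl andbC.
  by rewrite opprK addrC distrC.
- move=> s t bs st ta; rewrite metric_sym.
  have := H (- t) (- s); rewrite lerNr => /(_ ta); rewrite lerN2 => /(_ st).
  by rewrite lerNl => /(_ bs); rewrite opprK addrC.
- move=> s t bs st ta; rewrite metric_sym -[s]opprK -[t]opprK.
  have := K (- t) (- s); rewrite lerNr => /(_ ta); rewrite lerN2 => /(_ st).
  by rewrite lerNl => /(_ bs) /length_le_opp; rewrite !opprK.
Qed.

End Curves.

(** * Attaching geodesic legs to a quasi-geodesic *)

Section Legs.
Context {R : realType} {X : metricType R}.
Implicit Types (c : R -> X).

(* The middle piece has parameter length [s] and endpoints at distance [D], the
   two legs have total length [x]; [d] is the distance between their ends. *)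
Lemma legs_arith (l0 k0 x s D d : R) :
  1 <= l0 -> 0 <= k0 -> 0 <= x -> 0 <= s -> 0 <= D -> 0 <= d ->
  s <= l0 * (D + k0) -> D <= l0 * s + k0 -> D <= d + x -> d <= D + x ->
  x <= d \/ 4 * l0 * x <= s ->
  [/\ s + x <= (2 * l0 + 2) * (d + k0), d <= (2 * l0 + 2) * (s + x) + k0 &
    x + (improved_k1 l0 k0 * D + improved_k2 l0 k0) <=
    improved_k1 (2 * l0 + 2) k0 * d + improved_k2 (2 * l0 + 2) k0].
Proof.
move=> l1 k00 x0 s0 D0 dd0 sD Ds Dd dD alt.
rewrite /improved_k1 /improved_k2.
(* With [l0 = 1 + a] the claims follow linearly from the nonnegativity of products of nonnegative
   quantities. *)
have [a a0 l0E] : exists2 a, 0 <= a & l0 = 1 + a.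
  by exists (l0 - 1); rewrite ?subr_ge0// addrC subrK.
(* Both alternatives imply these bounds; in the second, [4 * x <= D + k0 <= d + x + k0]. *)
have [xd Dd'] : x <= d + k0 / 3 /\ D <= 2 * d + k0 / 3.
  case: alt => [xd|sx]; first by split; lra.
  have : 4 * x <= D + k0.
    have l00 : 0 < l0 by lra.
    rewrite -(ler_pM2l l00); apply: le_trans sD; apply: le_trans sx; lra.
  by move=> ?; split; lra.
move: sD Ds {alt}; rewrite l0E => sD Ds.
have a00 : 0 <= a * k0 by exact: mulr_ge0.
have a0d : 0 <= a * d by exact: mulr_ge0.
have k0d : 0 <= k0 * d by exact: mulr_ge0.
have [a2 k2] : 0 <= a * a /\ 0 <= k0 * k0 by split; exact: mulr_ge0.
split.
- have : (1 + a) * (D + k0) <= (1 + a) * (2 * d + k0 / 3 + k0).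
    by rewrite ler_pM2l; lra.
  lra.
- have := mulr_ge0 a0 x0; have := mulr_ge0 a0 s0; lra.
- have : (1 + a) * (1 + a + k0) * D <=
         (1 + a) * (1 + a + k0) * (2 * d + k0 / 3).
    by apply: ler_wpM2l => //; apply: mulr_ge0; lra.
  have := mulr_ge0 a0 a2; have := mulr_ge0 a0 k2; have := mulr_ge0 k00 a2.
  have := mulr_ge0 k00 k2; have := mulr_ge0 a2 dd0; have := mulr_ge0 a00 dd0.
  lra.
Qed.


Lemma within_itv_continuous_cat c (a m b : R) : a <= m <= b ->
  {within `[a, m], continuous c} -> {within `[m, b], continuous c} ->
  {within `[a, b], continuous c}.
Proof.
move=> /andP[am mb] c1 c2.
have -> : [set` `[a, b]] = [set` `[a, m]] `|` [set` `[m, b]].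
  apply/seteqP; split=> x /=; rewrite !in_itv /=.
    move=> /andP[ax xb].
    by have [xm|/ltW mx] := leP x m; [left|right]; apply/andP.
  by move=> [] /andP[u v]; apply/andP; split=> //; lra.
by apply: withinU_continuous => //; exact: itv_closed.
Qed.

Lemma within_itv_continuous_eq c c' (a b : R) :
  (forall t, a <= t <= b -> c t = c' t) ->
  {within `[a, b], continuous c} -> {within `[a, b], continuous c'}.
Proof.
move=> cc'; apply: subspace_eq_continuous => x; rewrite inE /= in_itv /=.
exact: cc'.
Qed.

Lemma within_itv_isometry c (a b : R) :
  (forall s t, a <= s -> s <= t -> t <= b -> mdist (c s) (c t) = t - s) ->
  {within `[a, b], continuous c}.
Proof.
move=> iso; apply/within_itv_continuousP => x /andP[ax xb] e e0.
exists e => // y /andP[ay yb]; apply: le_lt_trans.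
have [xy|/ltW yx] := leP x y; first by rewrite iso// distrC ler_norm.
by rewrite metric_sym iso// ler_norm.
Qed.

(** The estimates for a single pair [s <= t], with a leg on [[s, s']], the curve on [[s', t']] and a
    leg on [[t', t]]. Either leg may be trivial, which covers pairs with an end on the curve
    itself. *)
Lemma length_le_legs (l0 k0 s s' t' t : R) (eta : R -> X) :
  1 <= l0 -> 0 <= k0 -> s <= s' -> s' <= t' -> t' <= t ->
  mdist (eta s) (eta s') = s' - s -> length_le eta s s' (s' - s) ->
  mdist (eta t) (eta t') = t - t' -> length_le eta t' t (t - t') ->
  t' - s' <= l0 * (mdist (eta s') (eta t') + k0) ->
  mdist (eta s') (eta t') <= l0 * (t' - s') + k0 ->
  length_le eta s' t' (improved_k1 l0 k0 * mdist (eta s') (eta t') +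
                       improved_k2 l0 k0) ->
  (s' - s) + (t - t') <= mdist (eta s) (eta t) \/
    4 * l0 * ((s' - s) + (t - t')) <= t' - s' ->
  [/\ t - s <= (2 * l0 + 2) * (mdist (eta s) (eta t) + k0),
    mdist (eta s) (eta t) <= (2 * l0 + 2) * (t - s) + k0 &
    length_le eta s t (improved_k1 (2 * l0 + 2) k0 * mdist (eta s) (eta t) +
                       improved_k2 (2 * l0 + 2) k0)].
Proof.
move=> l1 k00 ss' s't' t't dS arcS dT arcT H1 H2 K1 alt.
have tri1 := metric_triangle (eta s) (eta s') (eta t).
have tri2 := metric_triangle (eta s') (eta t') (eta t).
have tri3 := metric_triangle (eta s') (eta s) (eta t').
have tri4 := metric_triangle (eta s) (eta t) (eta t').
rewrite (metric_sym (eta s') (eta s)) (metric_sym (eta t') (eta t)) dS dT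
  in tri1 tri2 tri3 tri4.
have x0 : 0 <= s' - s + (t - t') by lra.
have s0 : 0 <= t' - s' by lra.
have T1 :
    mdist (eta s') (eta t') <= mdist (eta s) (eta t) + (s' - s + (t - t')).
  by lra.
have T2 :
    mdist (eta s) (eta t) <= mdist (eta s') (eta t') + (s' - s + (t - t')).
  by lra.
have [] := legs_arith _ _ _ _ _ _ l1 k00 x0 s0 (mdist_ge0 _ _) (mdist_ge0 _ _)
  H1 H2 T1 T2 alt.
have -> : t' - s' + (s' - s + (t - t')) = t - s by ring.
move=> A1 A2 A3; split=> //; apply: length_le_mono A3 _.
rewrite addrAC -addrA; apply: (length_le_cat _ _ s') arcS _.
  by rewrite ss' (le_trans s't').
by apply: (length_le_cat _ _ t') K1 arcT; rewrite s't'.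
Qed.

(** Both times lie on the same leg: the middle piece degenerates to the point at [t]. *)
Lemma length_le_leg (l0 k0 s t : R) (eta : R -> X) :
  1 <= l0 -> 0 <= k0 -> s <= t ->
  mdist (eta s) (eta t) = t - s -> length_le eta s t (t - s) ->
  [/\ t - s <= (2 * l0 + 2) * (mdist (eta s) (eta t) + k0),
    mdist (eta s) (eta t) <= (2 * l0 + 2) * (t - s) + k0 &
    length_le eta s t (improved_k1 (2 * l0 + 2) k0 * mdist (eta s) (eta t) +
                       improved_k2 (2 * l0 + 2) k0)].
Proof.
move=> l1 k00 st dst arc.
have k10 : 0 <= improved_k1 l0 k0 by rewrite /improved_k1 mulr_ge0//; lra.
have k20 : 0 <= improved_k2 l0 k0.
  rewrite /improved_k2; apply: mulr_ge0; last lra.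
  by apply: addr_ge0 => //; apply: mulr_ge0; lra.
apply: (length_le_legs l0 k0 s t t t) => //; rewrite ?subrr ?addr0 ?mdistxx//.
- exact: length_le_refl.
- by rewrite add0r mulr_ge0//; lra.
- by rewrite mulr0 add0r.
- by apply: length_le_mono (length_le_refl _ _); rewrite mulr0 add0r.
- by left; rewrite dst.
Qed.

(* A leg starting at [y] and hitting the curve at a point closest to [y] cannot
   be shortcut, which is where the factor [2] comes from; when both legs are
   non-trivial they must be short compared to the curve. *)
Lemma quasi_geodesic_legs (l0 k0 al be r1 r2 : R) c g1 g2 :
  1 <= l0 -> 0 <= k0 -> al <= be -> 0 <= r1 -> 0 <= r2 ->
  quasi_geodesic l0 k0 `[al, be] c ->
  (forall s t, al - r1 <= s -> s <= t -> t <= al ->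
     mdist (g1 s) (g1 t) = t - s) -> g1 al = c al ->
  (forall s t, be <= s -> s <= t -> t <= be + r2 ->
     mdist (g2 s) (g2 t) = t - s) -> g2 be = c be ->
  (forall v, al <= v -> v <= be -> r1 <= mdist (g1 (al - r1)) (c v)) ->
  (forall v, al <= v -> v <= be -> r2 <= mdist (g2 (be + r2)) (c v)) ->
  [\/ r1 = 0, r2 = 0 | 4 * l0 * (r1 + r2) <= be - al] ->
  quasi_geodesic (2 * l0 + 2) k0 `[al - r1, be + r2]
    (fun t => if t < al then g1 t else if t <= be then c t else g2 t).
Proof.
move=> l1 k00 ab r10 r20 qc iso1 g1al iso2 g2be near1 near2 short.
set eta := fun t => _.
have l0gt0 : 0 < l0 by lra.
have L0 : 0 < 2 * l0 + 2 by lra.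
have E1 t : t <= al -> g1 t = eta t.
  by rewrite /eta le_eqVlt => /predU1P[->|->//]; rewrite ltxx ab.
have E2 t : al <= t <= be -> c t = eta t.
  by rewrite /eta => /andP[at_ ->]; rewrite ltNge at_.
have E3 t : be <= t -> g2 t = eta t.
  rewrite /eta => bt; rewrite ltNge (le_trans ab bt) /=.
  by case: (leP t be) => // tb; have -> : t = be by lra.
have [cc H K] := (quasi_geodesicP l0 k0 al be c l0gt0).1 qc.
apply/quasi_geodesicP => //.
suff main s t : al - r1 <= s -> s <= t -> t <= be + r2 ->
  [/\ t - s <= (2 * l0 + 2) * (mdist (eta s) (eta t) + k0),
    mdist (eta s) (eta t) <= (2 * l0 + 2) * (t - s) + k0 &
    length_le eta s t (improved_k1 (2 * l0 + 2) k0 * mdist (eta s) (eta t) +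
                       improved_k2 (2 * l0 + 2) k0)].
  split=> [|s t u v w|s t u v w]; last 2 first.
  - by have [] := main s t u v w.
  - by have [] := main s t u v w.
  apply: (within_itv_continuous_cat _ _ al); first lra.
    apply: (within_itv_continuous_eq g1); first by move=> t /andP[_ /E1].
    exact: within_itv_isometry.
  apply: (within_itv_continuous_cat _ _ be); first lra.
    exact: (within_itv_continuous_eq c).
  apply: (within_itv_continuous_eq g2); first by move=> t /andP[/E3].
  exact: within_itv_isometry.
move=> us st tv.
have arc1 u v : al - r1 <= u -> u <= v -> v <= al -> length_le eta u v (v - u).
  move=> ru uv va; apply: (length_le_eq g1).
    by move=> w /andP[_ wv]; apply: E1; lra.
  by apply: length_le_isometry => x y ? ? ?; apply: iso1; lra.
have arc3 u v : be <= u -> u <= v -> v <= be + r2 -> length_le eta u v (v - u).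
  move=> ru uv va; apply: (length_le_eq g2).
    by move=> w /andP[uw _]; apply: E3; lra.
  by apply: length_le_isometry => x y ? ? ?; apply: iso2; lra.
case: (leP t al) => [ta|at_].
  apply: length_le_leg => //; last exact: arc1.
  by rewrite -!E1 ?iso1// (le_trans st).
case: (leP be s) => [bs|sb].
  apply: length_le_leg => //; last exact: arc3.
  by rewrite -!E3 ?iso2// (le_trans bs).
(* [s'] is the time at which the part starting at [s] enters the curve. As the far end of the leg
   has its closest point at [al], so has every point of the leg, which gives the last clause. *)
have [s' [s's [s'a s'b dS arcS farS]]] : exists s',
   (s <= al /\ s' = al \/ al <= s /\ s' = s) /\ [/\ al <= s', s' <= be,
   mdist (eta s) (eta s') = s' - s, length_le eta s s' (s' - s) &
   forall v, al <= v -> v <= be -> s' - s <= mdist (eta s) (c v)].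
  clear H K; case: (leP al s) => [as_|/ltW sa].
    exists s; split; first by right.
    rewrite subrr mdistxx; split=> //; first exact: ltW.
      exact: length_le_refl.
    by move=> *; exact: mdist_ge0.
  exists al; split; first by left.
  split=> //; [by rewrite -!E1// iso1|exact: arc1|].
  move=> v av vb; have := near1 v av vb; rewrite -E1//.
  have := metric_triangle (g1 (al - r1)) (g1 s) (c v).
  by rewrite iso1//; lra.
have [t' [t't [t'a t'b dT arcT farT]]] : exists t',
   (be <= t /\ t' = be \/ t <= be /\ t' = t) /\ [/\ al <= t', t' <= be,
   mdist (eta t) (eta t') = t - t', length_le eta t' t (t - t') &
   forall v, al <= v -> v <= be -> t - t' <= mdist (eta t) (c v)].
  clear H K; case: (leP t be) => [tb|/ltW bt].
    exists t; split; first by right.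
    rewrite subrr mdistxx; split=> //; first exact: ltW.
      exact: length_le_refl.
    by move=> *; exact: mdist_ge0.
  exists be; split; first by left.
  split=> //; [|exact: arc3|].
    by rewrite metric_sym -!E3// iso2.
  move=> v av vb; have := near2 v av vb; rewrite -E3//.
  have := metric_triangle (g2 (be + r2)) (g2 t) (c v).
  by rewrite [X in _ <= X + _]metric_sym iso2//; lra.
(* If at most one of the two legs is non-trivial, the chord joins its far end to the curve and is at
   least as long as the leg. Otherwise [short] applies, since both legs are then cut off at most at
   their outer ends. *)
have alt : (s' - s) + (t - t') <= mdist (eta s) (eta t) \/
    4 * l0 * ((s' - s) + (t - t')) <= t' - s'.
  case: s's => -[sal s'E]; last first.
    left; rewrite s'E subrr add0r metric_sym -(E2 s) ?sal ?(ltW sb)//.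
    exact: farT _ sal (ltW sb).
  case: t't => -[tbe t'E]; last first.
    left; rewrite t'E subrr addr0 -(E2 t) ?(ltW at_)//.
    exact: farS _ (ltW at_) tbe.
  case: short => [r|r|short].
  - have sE : s = al by rewrite r subr0 in us; apply/le_anti; rewrite sal us.
    left; rewrite s'E sE subrr add0r metric_sym -(E2 al) ?lexx//.
    exact: farT.
  - have tE : t = be by rewrite r addr0 in tv; apply/le_anti; rewrite tv tbe.
    left; rewrite t'E tE subrr addr0 -(E2 be) ?lexx ?ab//.
    exact: farS.
  - rewrite s'E t'E; right; apply: le_trans short; rewrite ler_pM2l; lra.
have s't' : s' <= t'.
  by case: s's => -[_ ->]; case: t't => -[_ ->] //; exact: ltW.
have [H1 H2] := H s' t' s'a s't' t'b.
have K1 := K s' t' s'a s't' t'b.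
rewrite !E2 ?s'a ?t'a// in H1 H2 K1.
apply: (length_le_legs l0 k0 s s' t' t) => //.
- by case: s's => -[? ->].
- by case: t't => -[? ->].
- apply: length_le_eq K1 => v /andP[sv vt].
  by apply: E2; rewrite (le_trans s'a sv) (le_trans vt).
Qed.

End Legs.

(** * Weakly Morse paths and combing lines *)

Section Tracking.
Context {R : realType} {X : metricType R}.
Implicit Types (c p q : R -> X).

(** The neighbourhood is defined by an infimum; the slack [1] turns it into an actual point. *)
Lemma closed_neighbourhood_image (mu s t : R) p x :
  closed_neighbourhood mu (p @` `[s, t]) x ->
  exists sg, s <= sg <= t /\ mdist x (p sg) <= mu + 1.
Proof.
rewrite /closed_neighbourhood /= => H.
have /ereal_inf_lt [_ [_ [sg /= + <-] <-]] :
    (ereal_inf [set (mdist x y)%:E | y in p @` `[s, t]] < (mu + 1)%:E)%E.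
  by apply: le_lt_trans H _; rewrite lte_fin ltrDl.
by rewrite in_itv /= lte_fin => sgst /ltW; exists sg.
Qed.

(** Minimising over parameters rather than points allows their order along the line to be
    compared. *)
Definition closest_parameter (q : R -> X) (T : R) (y : X) (a : R) : Prop :=
  0 <= a <= T /\
  forall v, 0 <= v <= T -> mdist y (q a) <= mdist y (q v).

Lemma closest_parameter_exists q (T : R) y : 0 <= T ->
  {within `[0, T], continuous q} -> exists a, closest_parameter q T y a.
Proof.
move=> T0 cq.
have [|a aT amin] := @EVT_min R (fun v => mdist y (q v)) 0 T T0.
  apply/(@within_itv_continuousP R R^o) => v v0T e e0.
  have [d d0 dP] := (within_itv_continuousP q 0 T).1 cq v v0T e e0.
  exists d => // w w0T vw; apply: le_lt_trans (dP w w0T vw).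
  have := metric_triangle y (q v) (q w); have := metric_triangle y (q w) (q v).
  rewrite (metric_sym (q w)) => ? ?.
  change (`|mdist y (q w) - mdist y (q v)| <= mdist (q v) (q w)).
  by rewrite ler_norml; apply/andP; split; lra.
exists a; split; first by move: aT; rewrite in_itv.
by move=> v v0T; apply: amin; rewrite in_itv.
Qed.

Lemma geodesic_from (x y : X) (al : R) : geodesic_space X ->
  exists g : R -> X, [/\ g al = x, g (al + mdist x y) = y &
    forall s t, al <= s -> s <= t -> t <= al + mdist x y ->
      mdist (g s) (g t) = t - s].
Proof.
move=> /(_ x y)[g [g0 g1 iso]]; exists (fun t => g (t - al)).
rewrite subrr [al + _]addrC addrK; split=> // s t als st tr.
rewrite iso ?in_itv /=; last 2 first.
- by rewrite subr_ge0 als lerBlDr (le_trans st).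
- by rewrite subr_ge0 (le_trans als st) lerBlDr.
by rewrite distrC opprB addrA subrK ger0_norm// subr_ge0.
Qed.

(** The geodesics from [p u1] to [c al] and from [c be] to [p u2] extend [c] to a quasi-geodesic
    with endpoints on [p], to which the weak Morse property applies. *)
Lemma weakly_morse_legs (l0 k0 mu u1 u2 al be : R) c p :
  geodesic_space X -> 1 <= l0 -> 0 <= k0 -> u1 <= u2 -> al <= be ->
  weakly_morse (2 * l0 + 2) k0 mu `[u1, u2] p ->
  quasi_geodesic l0 k0 `[al, be] c ->
  (forall v, al <= v <= be -> mdist (p u1) (c al) <= mdist (p u1) (c v)) ->
  (forall v, al <= v <= be -> mdist (p u2) (c be) <= mdist (p u2) (c v)) ->
  [\/ mdist (p u1) (c al) = 0, mdist (p u2) (c be) = 0 |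
    4 * l0 * (mdist (p u1) (c al) + mdist (p u2) (c be)) <= be - al] ->
  forall v, al <= v <= be ->
    exists sg, u1 <= sg <= u2 /\ mdist (c v) (p sg) <= mu + 1.
Proof.
move=> gX l1 k00 u12 albe wm qc near1 near2 short v /andP[alv vbe].
set r1 := mdist (p u1) (c al) in near1 short *.
set r2 := mdist (p u2) (c be) in near2 short *.
have r10 : 0 <= r1 := mdist_ge0 _ _.
have r20 : 0 <= r2 := mdist_ge0 _ _.
have [g1 [g1y g1al iso1]] := geodesic_from (p u1) (c al) (al - r1) gX.
rewrite -/r1 subrK in g1al iso1.
have [g2 [g2be g2y iso2]] := geodesic_from (c be) (p u2) be gX.
rewrite (metric_sym (c be)) -/r2 in g2y iso2.
have := quasi_geodesic_legs l0 k0 al be r1 r2 c g1 g2 l1 k00 albe r10 r20 qc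
  iso1 g1al iso2 g2be.
rewrite g1y g2y => /(_ _ _ short) qeta.
have {}qeta := qeta (fun v av vb => near1 v (introT andP (conj av vb)))
  (fun v av vb => near2 v (introT andP (conj av vb))).
set eta := (fun t => _) in qeta.
have ev : eta v = c v by rewrite /eta ltNge alv /= vbe.
have := wm u1 u2 _ _ u12 (al - r1) (be + r2) eta _ qeta.
rewrite !in_itv /= !lexx u12 => /(_ isT isT) H.
apply: closed_neighbourhood_image; rewrite -ev; apply: H.
- lra.
(* For a leg of length zero the glued map takes the value of [c] here, which agrees with [p u1]
   because their distance is zero. *)
- rewrite /eta; case: ltP => [//|alr].
  have r1E : r1 = 0 by apply/le_anti; rewrite r10 andbT; lra.
  rewrite r1E subr0 albe.
  by apply/esym/(mdist_positivity (p u1)).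
- rewrite /eta ltNge; have -> : al <= be + r2 by lra.
  rewrite /=; case: leP => [ber|//].
  have r2E : r2 = 0 by apply/le_anti; rewrite r20 andbT; lra.
  by rewrite r2E addr0; apply/esym/(mdist_positivity (p u2)).
- by exists v => //=; rewrite in_itv /=; apply/andP; split; lra.
Qed.

(** The order of [a1] and [a2] is not known at this stage; if [a2 <= a1], the line is traversed
    backwards as [q (- t)]. *)
Lemma weakly_morse_combing (l0 k0 mu u1 u2 T a1 a2 : R) q p :
  geodesic_space X -> 1 <= l0 -> 0 <= k0 -> u1 <= u2 ->
  weakly_morse (2 * l0 + 2) k0 mu `[u1, u2] p ->
  quasi_geodesic l0 k0 `[0, T] q ->
  closest_parameter q T (p u1) a1 -> closest_parameter q T (p u2) a2 ->
  [\/ mdist (p u1) (q a1) = 0, mdist (p u2) (q a2) = 0 |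
    4 * l0 * (mdist (p u1) (q a1) + mdist (p u2) (q a2)) <= `|a1 - a2|] ->
  forall v, Num.min a1 a2 <= v <= Num.max a1 a2 ->
    exists sg, u1 <= sg <= u2 /\ mdist (q v) (p sg) <= mu + 1.
Proof.
move=> gX l1 k00 u12 wm qq [/andP[a10 a1T] near1] [/andP[a20 a2T] near2].
move=> short v.
have l00 : 0 < l0 by lra.
case: (leP a1 a2) => [a12|/ltW a21] vv.
  apply: (weakly_morse_legs l0 k0 mu u1 u2 a1 a2 q p) => //.
  - exact: quasi_geodesic_sub qq.
  - by move=> w /andP[? ?]; apply: near1; apply/andP; split; lra.
  - by move=> w /andP[? ?]; apply: near2; apply/andP; split; lra.
  - by move: short; rewrite distrC ger0_norm ?subr_ge0.
have := weakly_morse_legs l0 k0 mu u1 u2 (- a1) (- a2) (fun t => q (- t)) p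
  gX l1 k00 u12 _ wm _ _ _ _ (- v).
rewrite !opprK; apply.
- by rewrite lerN2.
- by apply: quasi_geodesic_opp => //; exact: quasi_geodesic_sub qq.
- by move=> w /andP[? ?]; apply: near1; apply/andP; split; lra.
- by move=> w /andP[? ?]; apply: near2; apply/andP; split; lra.
- by move: short; rewrite ger0_norm ?subr_ge0// [- a2 + a1]addrC.
- by rewrite !lerN2 andbC.
Qed.

(** A coarse substitute for connectedness: walking from [a] in unit steps, some step leads from [P]
    to [Q]. *)
Lemma unit_step_crossing (P Q : R -> Prop) (a b : R) : a <= b ->
  (forall v, a <= v <= b -> P v \/ Q v) -> P a -> Q b ->
  exists v w, [/\ a <= v <= b, a <= w <= b, `|v - w| <= 1, P v & Q w].
Proof.
move=> ab PQ Pa Qb.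
have [n] : exists n : nat, b - a <= n%:R.
  by exists (Num.bound (b - a)); apply/ltW/archi_boundP; rewrite subr_ge0.
elim: n a ab PQ Pa => [|n IH] a ab PQ Pa ban.
  exists a, b; rewrite !lexx ab; split=> //.
  by rewrite distrC ger0_norm ?subr_ge0//; lra.
have [ba1|ba1] := leP (b - a) 1.
  exists a, b; rewrite !lexx ab; split=> //.
  by rewrite distrC ger0_norm ?subr_ge0.
have aa : a <= a + 1 <= b by apply/andP; split; lra.
have [Pa1|Qa1] := PQ _ aa; last first.
  exists a, (a + 1); rewrite lexx ab; split=> //.
  by rewrite opprD addrA subrr add0r normrN1.
have [||||v [w [/andP[? ?] /andP[? ?] ? ? ?]]] := IH (a + 1).
- by case/andP: aa.
- by move=> v /andP[? ?]; apply: PQ; apply/andP; split; lra.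
- by [].
- by move: ban; rewrite -natr1; lra.
by exists v, w; split=> //; apply/andP; split; lra.
Qed.

(** The inner factor [lam * (...)] bounds the time between two points of [p] that are
    [(mu + 1)]-close to points of the line at most one unit of time apart. The rest is the distance
    travelled by [p] in that time, plus a last [mu + 1] to reach the line. *)
Definition tracking_constant (l0 k0 lam kap mu : R) : R :=
  lam * (lam * (2 * (mu + 1) + l0 + k0 + kap)) + kap + (mu + 1).

(** Every point of the line between [a1] and [a2] is close to [p] before or after [u]: before at
    [a1], after at [a2]. Where this changes, the line is close to [p] on both sides of [u], at times
    that must then be close to [u]. *)
Lemma combing_tracks_between (l0 k0 lam kap mu u1 u u2 T a1 a2 : R) q p :
  geodesic_space X -> 1 <= l0 -> 0 <= k0 -> 1 <= lam -> 0 <= kap -> 0 <= mu ->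
  u1 <= u <= u2 -> quasi_geodesic lam kap `[u1, u2] p ->
  weakly_morse (2 * l0 + 2) k0 mu `[u1, u2] p ->
  quasi_geodesic l0 k0 `[0, T] q ->
  closest_parameter q T (p u1) a1 -> closest_parameter q T (p u2) a2 ->
  [\/ mdist (p u1) (q a1) = 0, mdist (p u2) (q a2) = 0 |
    4 * l0 * (mdist (p u1) (q a1) + mdist (p u2) (q a2)) <= `|a1 - a2|] ->
  mdist (p u1) (q a1) = 0 \/
    lam * (mdist (p u1) (q a1) + (mu + 1) + kap) <= u - u1 ->
  mdist (p u2) (q a2) = 0 \/
    lam * (mdist (p u2) (q a2) + (mu + 1) + kap) <= u2 - u ->
  exists2 v, Num.min a1 a2 <= v <= Num.max a1 a2 &
    mdist (p u) (q v) <= tracking_constant l0 k0 lam kap mu.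
Proof.
move=> gX l1 k00 lam1 kap0 mu0 /andP[u1u uu2] qp wm qq cl1 cl2 short far1 far2.
have lam0 : 0 < lam by lra.
have l00 : 0 < l0 by lra.
have cover := weakly_morse_combing l0 k0 mu u1 u2 T a1 a2 q p gX l1 k00
  (le_trans u1u uu2) wm qq cl1 cl2 short.
have [_ H _] := (quasi_geodesicP lam kap u1 u2 p lam0).1 qp.
have [_ Hq _] := (quasi_geodesicP l0 k0 0 T q l00).1 qq.
pose P v := exists sg, u1 <= sg <= u /\ mdist (q v) (p sg) <= mu + 1.
pose Q v := exists sg, u <= sg <= u2 /\ mdist (q v) (p sg) <= mu + 1.
have PQ v : Num.min a1 a2 <= v <= Num.max a1 a2 -> P v \/ Q v.
  move=> /cover[sg [/andP[s1 s2] ds]]; have [su|/ltW us] := leP sg u.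
    by left; exists sg; rewrite s1 su.
  by right; exists sg; rewrite us s2.
(* Either [q a1] is [p u1] itself, or a point of [p] close to [q a1] is so close to [p u1] that its
   time cannot exceed [u]. *)
have Pa1 : P a1.
  have [r0|far] := far1.
    by exists u1; rewrite lexx u1u metric_sym r0; split=> //; lra.
  have [|sg [/andP[s1 s2] ds]] := cover a1; first by rewrite ge_min le_max lexx.
  exists sg; rewrite s1; split=> //.
  have [D1 _] := H u1 sg (lexx _) s1 s2.
  have D2 := metric_triangle (p u1) (q a1) (p sg).
  have : lam * (mdist (p u1) (p sg) + kap) <=
     lam * (mdist (p u1) (q a1) + (mu + 1) + kap) by rewrite ler_pM2l//; lra.
  lra.
have Qa2 : Q a2.
  have [r0|far] := far2.
    by exists u2; rewrite lexx uu2 metric_sym r0; split=> //; lra.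
  have [|sg [/andP[s1 s2] ds]] := cover a2.
    by rewrite ge_min le_max lexx !orbT.
  exists sg; rewrite s2 andbT; split=> //.
  have [D1 _] := H sg u2 s1 s2 (lexx _).
  have D2 := metric_triangle (p u2) (q a2) (p sg).
  rewrite (metric_sym (p sg)) in D1.
  have : lam * (mdist (p u2) (p sg) + kap) <=
     lam * (mdist (p u2) (q a2) + (mu + 1) + kap) by rewrite ler_pM2l//; lra.
  lra.
have [v [w [vab wab vw Pv Qw]]] : exists v w,
    [/\ Num.min a1 a2 <= v <= Num.max a1 a2,
        Num.min a1 a2 <= w <= Num.max a1 a2,
        `|v - w| <= 1, P v & Q w].
  move: PQ; case: (leP a1 a2) => [a12|/ltW a21] PQ.
    exact: unit_step_crossing.
  have [|v [w [? ? ? ? ?]]] := unit_step_crossing Q P a2 a1 a21 _ Qa2 Pa1.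
    by move=> v /PQ[]; [right|left].
  by exists w, v; rewrite distrC.
exists v => //.
case: Pv => s1 [/andP[us1 s1u] d1]; case: Qw => s2 [/andP[us2 s2u] d2].
have [a0T b0T] : 0 <= Num.min a1 a2 /\ Num.max a1 a2 <= T.
  case: cl1 => /andP[? ?] _; case: cl2 => /andP[? ?] _.
  by rewrite le_min ge_max; split; apply/andP.
have dvw : mdist (q v) (q w) <= l0 + k0.
  case/andP: vab => v1 v2; case/andP: wab => w1 w2.
  have l0vw : l0 * `|v - w| <= l0 by rewrite -[leRHS]mulr1 ler_pM2l.
  have [vw'|/ltW wv] := leP v w.
    have [_ E] := Hq v w (le_trans a0T v1) vw' (le_trans w2 b0T).
    rewrite distrC ger0_norm ?subr_ge0// in l0vw; clear - E l0vw; lra.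
  have [_ E] := Hq w v (le_trans a0T w1) wv (le_trans v2 b0T).
  rewrite ger0_norm ?subr_ge0// in l0vw; rewrite metric_sym.
  clear - E l0vw; lra.
have [E1 _] := H s1 s2 us1 (le_trans s1u us2) s2u.
have [_ E2] := H s1 u us1 s1u uu2.
have T1 := metric_triangle (p s1) (q v) (p s2).
have T2 := metric_triangle (q v) (q w) (p s2).
have T3 := metric_triangle (p u) (p s1) (q v).
rewrite (metric_sym (p s1) (q v)) in T1.
rewrite (metric_sym (p u) (p s1)) (metric_sym (p s1) (q v)) in T3.
have F1 : s2 - s1 <= lam * (2 * (mu + 1) + l0 + k0 + kap).
  by apply: le_trans E1 _; rewrite ler_pM2l//; lra.
have F2 : lam * (u - s1) <= lam * (lam * (2 * (mu + 1) + l0 + k0 + kap)).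
  by rewrite ler_pM2l//; lra.
rewrite /tracking_constant; lra.
Qed.

End Tracking.

(** * From local to global *)

Lemma length_le_chain (R : realType) (X : metricType R) (p : R -> X)
    (L M s t : R) (n : nat) : 0 < L ->
  (forall u v, s <= u -> u <= v -> v <= t -> v - u <= L -> length_le p u v M) ->
  s <= t -> t - s <= n.+1%:R * L -> length_le p s t (n.+1%:R * M).
Proof.
move=> L0 short; elim: n s short => [|n IH] s short st tL.
  by rewrite mul1r; apply: short; rewrite ?lexx//; rewrite mul1r in tL.
(* The empty subdivision shows [0 <= M], so fewer than [n.+1] pieces may be used. *)
have M0 : 0 <= M.
  have := short t t st (lexx _) (lexx _); rewrite subrr => /(_ (ltW L0) [::]).
  by rewrite /= lexx; apply.
have [tsL|/ltW sLt] := leP t (s + L).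
  apply: length_le_mono (short s t _ _ _ _) => //; last by lra.
  by rewrite ler_peMl// ler1n.
rewrite -natr1 addrC mulrDl mul1r.
apply: (length_le_cat p s (s + L)).
- by rewrite lerDl ltW.
- by apply: short; rewrite ?lexx ?lerDl ?(ltW L0)// addrAC subrr add0r.
- apply: IH => //.
  + by move=> u v su; apply: short; lra.
  + by rewrite -natr1 mulrDl in tL; lra.
Qed.

Section LocalToGlobal.
Context {R : realType} {X : metricType R}.
Variables (l0 k0 : R) (T : X -> X -> R) (cq : X -> X -> R -> X).
Hypotheses (gX : geodesic_space X) (l1 : 1 <= l0) (k00 : 0 <= k0).
Hypothesis combing : quasi_geodesic_combing l0 k0 T cq.
Hypothesis bounded : bounded_combing k0 cq.
Variables (lam kap mu : R).
Hypotheses (lam1 : 1 <= lam) (kap0 : 0 <= kap) (mu0 : 0 <= mu).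

Let A := tracking_constant l0 k0 lam kap mu.

(* Moving the endpoint of a combing line by at most one unit of time along the
   path turns the tracking constant [A] into [B]. *)
Let B := A + (k0 + 1) * (lam + kap) + k0.

(** Separation of closest parameters: the first term makes two legs of length at most [B] short
    enough to be attached, the second prevents the line from turning back, and the [1] makes each
    step at least one unit of time. *)
Let G := 8 * l0 * B + l0 * (2 * B + k0) + 1.
(** Time step along [p], large enough to force closest parameters [G] apart and to satisfy the
    conditions on [u - u1] and [u2 - u] in [combing_tracks_between] with legs up to [B]. *)
Let L := 1 + lam * (l0 * G + 2 * B + k0 + kap + mu).

Let lam0 : 0 < lam. Proof. exact: lt_le_trans lam1. Qed.
Let l00 : 0 < l0. Proof. exact: lt_le_trans l1. Qed.

(* [lra] ignores section hypotheses. *)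
Ltac const_lra := have := lam0; have := l00; have := k00; have := kap0;
  have := mu0; lra.

Let A0 : 0 <= A.
Proof.
have W : 0 <= 2 * (mu + 1) + l0 + k0 + kap by const_lra.
have := mulr_ge0 (ltW lam0) (mulr_ge0 (ltW lam0) W).
by rewrite /A /tracking_constant; const_lra.
Qed.

Let AB : A + lam + kap <= B.
Proof.
have := mulr_ge0 k00 (addr_ge0 (ltW lam0) kap0).
by rewrite /B; const_lra.
Qed.

Let B0 : 0 <= B. Proof. by move: A0 AB; const_lra. Qed.

Let G1 : [/\ 1 <= G, 8 * l0 * B <= G & l0 * (2 * B + k0) < G].
Proof.
have := mulr_ge0 (ltW l00) B0; have := mulr_ge0 (ltW l00) k00.
by rewrite /G => ? ?; split; const_lra.
Qed.

Let L1 : 1 <= L.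
Proof.
have [g1 _ _] := G1; have := mulr_ge0 (ltW l00) (le_trans ler01 g1) => l0G.
by rewrite /L lerDl; apply: mulr_ge0; move: B0; const_lra.
Qed.

Let L_far : lam * (B + (mu + 1) + kap) <= L.
Proof.
have [g1 _ _] := G1.
have l0G : 1 * 1 <= l0 * G by apply: ler_pM.
have : lam * (B + (mu + 1) + kap) <= lam * (l0 * G + 2 * B + k0 + kap + mu).
  by rewrite ler_pM2l//; have := B0; const_lra.
by rewrite /L; lra.
Qed.

Ltac segment_lra := have := A0; have := AB; have := L1; const_lra.

(** * Combing lines along a segment of the path *)

Section Segment.
Variables (p : R -> X) (s0 e : R).
Hypothesis local : forall t1 t2, s0 <= t1 -> t1 <= t2 -> t2 <= e ->
  t2 - t1 <= 2 * L -> quasi_geodesic lam kap `[t1, t2] p /\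
    weakly_morse (2 * l0 + 2) k0 mu `[t1, t2] p.

Local Notation line t := (cq (p s0) (p t)).
Local Notation time t := (T (p s0) (p t)).

Definition tracks (C t : R) : Prop := forall u, s0 <= u -> u <= t ->
  exists2 v, 0 <= v <= time t & mdist (p u) (line t v) <= C.

Let line0 t : line t 0 = p s0.
Proof. by have [_ _ -> //] := combing (p s0) (p t). Qed.

Let lineT t : line t (time t) = p t.
Proof. by have [_ _ _ ->] := combing (p s0) (p t). Qed.

Let time_ge0 t : 0 <= time t.
Proof. by have [] := combing (p s0) (p t). Qed.

Let line_qg t : quasi_geodesic l0 k0 `[0, time t] (line t).
Proof. by have [] := combing (p s0) (p t). Qed.

Let local_dist t1 t2 : s0 <= t1 -> t1 <= t2 -> t2 <= e -> t2 - t1 <= 2 * L ->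
  t2 - t1 <= lam * (mdist (p t1) (p t2) + kap) /\
  mdist (p t1) (p t2) <= lam * (t2 - t1) + kap.
Proof.
move=> s1 t12 te tL; have [q _] := local t1 t2 s1 t12 te tL.
by have [_ H _] := (quasi_geodesicP _ _ _ _ _ lam0).1 q; exact: H.
Qed.

Let closest t u : exists a, closest_parameter (line t) (time t) (p u) a.
Proof. by apply: closest_parameter_exists => //; have [] := line_qg t. Qed.

Let closest_dist C t u a : tracks C t -> s0 <= u -> u <= t ->
  closest_parameter (line t) (time t) (p u) a ->
  mdist (p u) (line t a) <= C.
Proof.
move=> tr su ut [_ near]; have [v vT dv] := tr u su ut.
exact: le_trans (near v vT) dv.
Qed.

(** The line passes through [p s0], so the leg there has length zero. With its counterpart at [p t],
    this handles windows cut off at an end of the segment. *)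
Let closest_start t a : closest_parameter (line t) (time t) (p s0) a ->
  mdist (p s0) (line t a) = 0.
Proof.
case=> _ /(_ 0); rewrite lexx time_ge0 line0 mdistxx => /(_ isT) d0.
by apply/le_anti; rewrite d0 mdist_ge0.
Qed.

Let closest_end t a : closest_parameter (line t) (time t) (p t) a ->
  mdist (p t) (line t a) = 0.
Proof.
case=> _ /(_ (time t)); rewrite lexx time_ge0 lineT mdistxx => /(_ isT) d0.
by apply/le_anti; rewrite d0 mdist_ge0.
Qed.

(** The local lower bound puts [p u] and [p u'] far apart; passing to their closest points costs at
    most [2 * B], and the line needs time [G] to cover what remains. *)
Let separation t u u' a a' : tracks B t -> s0 <= u -> u' <= t -> t <= e ->
  L <= u' - u <= 2 * L ->
  closest_parameter (line t) (time t) (p u) a ->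
  closest_parameter (line t) (time t) (p u') a' -> G <= `|a - a'|.
Proof.
move=> tr su u't te /andP[Lu uL] ca ca'.
have uu' : u <= u' by segment_lra.
have da := closest_dist B t u a tr su (le_trans uu' u't) ca.
have da' := closest_dist B t u' a' tr (le_trans su uu') u't ca'.
have [D1 _] := local_dist u u' su uu' (le_trans u't te) uL.
have D2 : mdist (line t a) (line t a') <= l0 * `|a - a'| + k0.
  have [_ H _] := line_qg t.
  have aI : a \in `[0, time t] by rewrite in_itv; case: ca.
  have a'I : a' \in `[0, time t] by rewrite in_itv; case: ca'.
  by case/andP: (H a a' aI a'I).
have T1 := metric_triangle (p u) (line t a) (p u').
have T2 := metric_triangle (line t a) (line t a') (p u').
rewrite (metric_sym (line t a')) in T2.
rewrite -(ler_pM2l l00).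
have D3 : l0 * G + 2 * B + k0 + kap + mu <= mdist (p u) (p u') + kap.
  by rewrite -(ler_pM2l lam0); move: Lu; rewrite /L; segment_lra.
segment_lra.
Qed.

(** An end of the window that is not at distance [L] from [u] is an end of the segment, where the
    leg vanishes. If neither is, [separation] makes the piece of line long enough for both legs. *)
Let between t u1 u u2 a1 a2 : tracks B t -> s0 <= u1 -> u2 <= t -> t <= e ->
  u1 <= u -> u <= u2 -> u2 - u1 <= 2 * L ->
  u1 = s0 \/ L <= u - u1 -> u2 = t \/ L <= u2 - u ->
  closest_parameter (line t) (time t) (p u1) a1 ->
  closest_parameter (line t) (time t) (p u2) a2 ->
  exists2 v, Num.min a1 a2 <= v <= Num.max a1 a2 & mdist (p u) (line t v) <= A.
Proof.
move=> tr su1 u2t te u1u uu2 u12 far1 far2 c1 c2.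
have u1u2 := le_trans u1u uu2.
have [qp wm] := local u1 u2 su1 u1u2 (le_trans u2t te) u12.
have d1 := closest_dist B t u1 a1 tr su1 (le_trans u1u2 u2t) c1.
have d2 := closest_dist B t u2 a2 tr (le_trans su1 u1u2) u2t c2.
apply: (combing_tracks_between l0 k0 lam kap mu u1 u u2 (time t) a1 a2) => //.
- by rewrite u1u.
- case: far1 => [u1E|far1].
    by apply: Or31; rewrite u1E in c1 *; exact: closest_start.
  case: far2 => [u2E|far2].
    by apply: Or32; rewrite u2E in c2 *; exact: closest_end.
  apply: Or33; have := separation t u1 u2 a1 a2 tr su1 u2t te _ c1 c2.
  rewrite u12 andbT => /(_ _) sep.
  have [_ G8 _] := G1.
  apply: le_trans (sep _); last by segment_lra.
  apply: le_trans G8; rewrite [8](_ : _ = 4 * 2); last by ring.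
  rewrite -[leRHS]mulrA -[leRHS]mulrA -[leLHS]mulrA; rewrite ler_pM2l//.
  by rewrite [leRHS]mulrCA ler_pM2l//; segment_lra.
- case: far1 => [u1E|far1]; [left|right].
    by rewrite u1E in c1 *; exact: closest_start.
  apply: le_trans far1; apply: le_trans L_far.
  by rewrite ler_pM2l//; segment_lra.
- case: far2 => [u2E|far2]; [left|right].
    by rewrite u2E in c2 *; exact: closest_end.
  apply: le_trans far2; apply: le_trans L_far.
  by rewrite ler_pM2l//; segment_lra.
Qed.

(** The window is [[u - L, u + L]] cut off at [s0] and [t]; its length explains the scale
    [2 * L]. *)
Lemma tracks_improve t : t <= e -> tracks B t -> tracks A t.
Proof.
move=> te tr u su ut.
have [u1 [su1 u1u uu1 far1]] : exists u1,
    [/\ s0 <= u1, u1 <= u, u - u1 <= L & u1 = s0 \/ L <= u - u1].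
  have [sL|/ltW Ls] := leP s0 (u - L).
    by exists (u - L); split; last right; segment_lra.
  by exists s0; split=> //; [segment_lra|left].
have [u2 [u2t uu2 u2u far2]] : exists u2,
    [/\ u2 <= t, u <= u2, u2 - u <= L & u2 = t \/ L <= u2 - u].
  have [sL|/ltW Ls] := leP (u + L) t.
    by exists (u + L); split; last right; segment_lra.
  by exists t; split=> //; [segment_lra|left].
have [a1 c1] := closest t u1; have [a2 c2] := closest t u2.
have [|v /andP[v1 v2] dv] := between t u1 u u2 a1 a2 tr su1 u2t te u1u uu2 _
  far1 far2 c1 c2; first by segment_lra.
exists v => //; case: c1 => /andP[a10 a1T] _; case: c2 => /andP[a20 a2T] _.
apply/andP; split; [apply: le_trans v1|apply: (le_trans v2)].
  by rewrite le_min a10.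
by rewrite ge_max a1T.
Qed.

(** Up to [t'] the same parameter is used on both lines, which start at the same point, so
    boundedness applies. After [t'] the endpoint of the new line is near enough. *)
Lemma tracks_step t t' : s0 <= t' -> t' <= t -> t - t' <= 1 -> t <= e ->
  tracks A t' -> tracks B t.
Proof.
move=> st' t't tt1 te tr u su ut.
have short w : t' <= w -> w <= t -> mdist (p w) (p t) <= lam + kap.
  move=> t'w wt; have [||||_] := local_dist w t;
    [segment_lra|segment_lra|segment_lra|segment_lra|].
  have : lam * (t - w) <= lam * 1 by rewrite ler_pM2l//; segment_lra.
  segment_lra.
have [ut'|/ltW t'u] := leP u t'; last first.
  exists (time t); first by rewrite time_ge0 lexx.
  by rewrite lineT; have := short u t'u ut; segment_lra.
have [v /andP[v0 vT] dv] := tr u su ut'.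
(* The new line may stop before time [v]; it is constant from then on, so truncating does not move
   the point. *)
exists (Num.min v (time t));
  first by rewrite le_min v0 time_ge0 ge_min lexx orbT.
have -> : line t (Num.min v (time t)) = line t v.
  case: leP => // /ltW Tv; have [_ _ _ H] := combing (p s0) (p t).
  by rewrite lineT H.
have := bounded v (p s0) (p t') (p t).
have := metric_triangle (p u) (line t' v) (line t v).
have : k0 * mdist (p t') (p t) <= k0 * (lam + kap).
  by apply: ler_wpM2l => //; exact: short.
rewrite /B; segment_lra.
Qed.

Lemma tracks_all t : s0 <= t -> t <= e -> tracks A t.
Proof.
move=> st te; have [n] : exists n : nat, t - s0 <= n%:R.
  by exists (Num.bound (t - s0)); apply/ltW/archi_boundP; rewrite subr_ge0.
elim: n t st te => [|n IH] t st te tn.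
  move=> u su ut; exists 0; first by rewrite lexx time_ge0.
  have -> : u = s0 by segment_lra.
  by rewrite line0 mdistxx.
apply: tracks_improve => //.
rewrite -natr1 in tn.
(* If [t - 1] lies before [s0], the step starts from [s0] instead. *)
have [t1|/ltW t1] := leP s0 (t - 1).
  apply: (tracks_step t (t - 1));
    [segment_lra|segment_lra|segment_lra|segment_lra|].
  by apply: IH; segment_lra.
apply: (tracks_step t s0); [segment_lra|segment_lra|segment_lra|segment_lra|].
by apply: IH; rewrite ?lexx ?subrr//; segment_lra.
Qed.

(** [separation] gives the size of the step; only its sign needs the induction. *)
Lemma closest_parameter_increasing t (i : nat) a a' : t <= e ->
  s0 + i.+1%:R * L <= t ->
  closest_parameter (line t) (time t) (p (s0 + i%:R * L)) a ->
  closest_parameter (line t) (time t) (p (s0 + i.+1%:R * L)) a' ->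
  a + G <= a'.
Proof.
move=> te; have [st|ts] := leP s0 t; last first.
  have := mulr_ge0 (ler0n R i.+1) (le_trans ler01 L1); segment_lra.
have [_ _ G3] := G1.
have trA := tracks_all t st te.
have trB : tracks B t.
  move=> u su ut; have [v vT dv] := trA u su ut.
  by exists v => //; apply: le_trans dv _; segment_lra.
have [_ H _] := (quasi_geodesicP _ _ _ _ _ l00).1 (line_qg t).
elim: i a a' => [|i IH] a a' it ca ca'.
  rewrite mul0r addr0 in ca; rewrite mul1r in ca' it.
  have sep : G <= `|a - a'|.
    apply: (separation t s0 (s0 + L)) => //.
    by rewrite addrAC subrr add0r lexx; segment_lra.
  have d0 := closest_start t a ca.
  case: ca => /andP[a0 aT] _; case: ca' => /andP[a'0 a'T] _.
  have [H0 _] := H 0 a (lexx _) a0 aT.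
  rewrite line0 d0 subr0 add0r in H0.
  have H1 : l0 * k0 <= l0 * (2 * B + k0) by rewrite ler_pM2l//; segment_lra.
  (* [line t a] is [p s0], hence [a <= l0 * k0 < G] and there is no room for [a'] below [a]. *)
  have [aa'|/ltW a'a] := leP a a'.
    by rewrite distrC ger0_norm ?subr_ge0// in sep; segment_lra.
  by rewrite ger0_norm ?subr_ge0// in sep; segment_lra.
have iL := mulr_ge0 (ler0n R i) (le_trans ler01 L1).
rewrite -[i.+2%:R]natr1 -[i.+1%:R]natr1 in it ca ca' *.
rewrite -[i.+1%:R]natr1 in IH.
set x := s0 + i%:R * L in IH.
have e1 : s0 + (i%:R + 1) * L = x + L by rewrite /x; ring.
have e2 : s0 + (i%:R + 1 + 1) * L = x + L + L by rewrite /x; ring.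
rewrite e1 in IH ca; rewrite e2 in it ca'.
have sx : s0 <= x by rewrite /x lerDl.
have [a'' ca''] := closest t x.
have aa'' : a'' + G <= a by apply: IH => //; segment_lra.
have sep : G <= `|a - a'|.
  apply: (separation t (x + L) (x + L + L)) => //; first by segment_lra.
  by rewrite addrAC subrr add0r lexx; segment_lra.
have [|||||v /andP[v1 v2] dv] :=
    between t x (x + L) (x + L + L) a'' a' trB sx it te _ _ _ _ _ ca'' ca'.
- by segment_lra.
- by segment_lra.
- by segment_lra.
- by right; segment_lra.
- by right; segment_lra.
have da : mdist (p (x + L)) (line t a) <= A.
  by apply: closest_dist ca => //; segment_lra.
have [aa'|/ltW a'a] := leP a a'.
  by rewrite distrC ger0_norm ?subr_ge0// in sep; segment_lra.
rewrite ger0_norm ?subr_ge0// in sep.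
(* If [a' <= a], then [a''] and [a'], hence [v], are at most [a - G]. But [line t v] and [line t a]
   are both within [A] of [p (x + L)], so [a - v <= l0 * (2 * B + k0) < G], a contradiction. *)
have va : v <= a - G.
  by apply: le_trans v2 _; rewrite ge_max; apply/andP; split; segment_lra.
case: ca => /andP[a0 aT] _; case: ca' => /andP[a'0 a'T] _.
case: ca'' => /andP[a''0 a''T] _.
have v0 : 0 <= v by apply: le_trans v1; rewrite le_min a''0.
have aGa : a - G <= a by have [? _ _] := G1; segment_lra.
have [H0 _] := H v a v0 (le_trans va aGa) aT.
have T1 := metric_triangle (line t v) (p (x + L)) (line t a).
rewrite (metric_sym (line t v) (p _)) in T1.
have H1 : l0 * (mdist (line t v) (line t a) + k0) <= l0 * (2 * B + k0).
  by rewrite ler_pM2l//; segment_lra.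
segment_lra.
Qed.

Lemma combing_time_ge t (n : nat) : t <= e ->
  s0 + n%:R * L <= t -> n%:R <= time t.
Proof.
move=> te nt; have [a ca] := closest t (s0 + n%:R * L).
apply: le_trans (_ : a <= _); last by case: ca => /andP[].
elim: n nt a ca => [|n IH] nt a ca; first by case: ca => /andP[].
have nL : s0 + n%:R * L <= t.
  by apply: le_trans nt; rewrite -natr1 mulrDl; segment_lra.
have [a' ca'] := closest t (s0 + n%:R * L).
have := closest_parameter_increasing t n a' a te nt ca' ca.
have := IH nL a' ca'; rewrite -natr1; have [? _ _] := G1; segment_lra.
Qed.

(** Bound for the length of [p] over a time interval of length at most [L]. *)
Let M := improved_k1 lam kap * (lam * L + kap) + improved_k2 lam kap.

(** The number [n] of full steps of length [L] links the three quantities to be compared: elapsed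
    time, distance of the endpoints (through the combing time) and length of the path. *)
Lemma segment_bounds : s0 <= e -> exists n : nat,
  [/\ n%:R <= e - s0, e - s0 <= n.+1%:R * L,
      n%:R <= l0 * (mdist (p s0) (p e) + k0) &
      length_le p s0 e (n.+1%:R * M)].
Proof.
move=> se; have Lgt0 : 0 < L := lt_le_trans ltr01 L1.
have /andP[n1 /ltW n2] : (Num.truncn ((e - s0) / L))%:R <= (e - s0) / L <
    (Num.truncn ((e - s0) / L)).+1%:R.
  by apply: truncn_itv; apply: divr_ge0; [lra|exact: ltW].
set n := Num.truncn _ in n1 n2; exists n.
rewrite ler_pdivlMr// in n1; rewrite ler_pdivrMr// in n2.
have nT : n%:R <= time e by apply: combing_time_ge => //; lra.
have [_ H _] := (quasi_geodesicP _ _ _ _ _ l00).1 (line_qg e).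
have [D _] := H 0 (time e) (lexx _) (time_ge0 e) (lexx _).
rewrite line0 lineT subr0 in D.
split=> //; [|exact: le_trans D|].
  by apply: le_trans n1; rewrite ler_peMr// L1.
apply: length_le_chain Lgt0 _ se n2 => u v su uv ve vuL.
have [|q _] := local u v su uv ve; first by segment_lra.
have [_ K1 K2] := (quasi_geodesicP _ _ _ _ _ lam0).1 q.
apply: length_le_mono (K2 u v (lexx _) uv (lexx _)).
rewrite /M lerD2r; apply: ler_wpM2l.
  by apply: mulr_ge0; segment_lra.
have [_ D2] := K1 u v (lexx _) uv (lexx _); apply: le_trans D2 _.
by rewrite lerD2r ler_pM2l.
Qed.

End Segment.

(** * Global constants *)

Lemma local_to_global : exists D lam' kap' : R,
  [/\ 0 <= D, 1 <= lam', 0 <= kap' &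
    forall (I : interval R) (p : R -> X), is_path I p ->
      locally_on D
        (fun J g => quasi_geodesic lam kap J g /\
           weakly_morse (2 * l0 + 2) k0 mu J g) I p ->
      quasi_geodesic lam' kap' I p].
Proof.
pose M := improved_k1 lam kap * (lam * L + kap) + improved_k2 lam kap.
have lamL : 0 <= lam * L by apply: mulr_ge0; segment_lra.
have M0 : 0 <= M.
  rewrite /M /improved_k1 /improved_k2; apply: addr_ge0; apply: mulr_ge0.
  - by apply: mulr_ge0; const_lra.
  - by const_lra.
  - by apply: addr_ge0 => //; apply: mulr_ge0; const_lra.
  - by const_lra.
have Ll0 : 1 * 1 <= L * l0 by apply: ler_pM => //; exact: L1.
have l0M : 0 <= l0 * M by apply: mulr_ge0 => //; exact: ltW.
have l0k0M : 0 <= l0 * k0 * M by rewrite !mulr_ge0// ltW.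
(* [L * l0] and [1 + k0] serve the lower bound, the term [M] in [lam'] and in [kap'] the upper
   bound. The products with [M] in [kap'] absorb the length estimate [(l0 * (d + k0) + 1) * M]. *)
pose lam' := 1 + L * l0 + M.
pose kap' := 1 + k0 + 2 * M + l0 * M + l0 * k0 * M.
have lam'1 : 1 <= lam' by rewrite /lam'; lra.
have kap'0 : 0 <= kap' by rewrite /kap'; const_lra.
exists (2 * L), lam', kap'; split=> //; first by segment_lra.
move=> I p pI loc.
(* Each pair of times is treated as the two ends of its own segment, so [I] may be unbounded or of
   any type. *)
have main s t : s \in I -> t \in I -> s <= t ->
   [/\ t - s <= lam' * (mdist (p s) (p t) + kap'),
     mdist (p s) (p t) <= lam' * (t - s) + kap' &
     length_le p s t (improved_k1 lam' kap' * mdist (p s) (p t) +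
                      improved_k2 lam' kap')].
  move=> sI tI st.
  have [t1 t2 s1 t12 te t12L|n [n1 n2 n3 len]] := segment_bounds p s t _ st.
    have inI u : s <= u <= t -> u \in I.
      move=> /andP[su ut].
      by apply: (interval_is_interval sI tI); rewrite su ut.
    apply: loc => //; first by apply: inI; rewrite s1 (le_trans t12).
      by apply: inI; rewrite te andbT (le_trans s1).
    by rewrite distrC ger0_norm ?subr_ge0.
  rewrite -/M in len.
  have dlen := length_le_dist p s t _ st len.
  have d0 := mdist_ge0 (p s) (p t).
  move: dlen d0 n3 len; set d := mdist _ _ => dlen d0 n3 len.
  have nM : n%:R * M <= (l0 * (d + k0)) * M by apply: ler_wpM2r.
  have nM' : n%:R * M <= (t - s) * M by apply: ler_wpM2r.
  have nL : n%:R * L <= (l0 * (d + k0)) * L.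
    by apply: ler_wpM2r n3; exact: le_trans L1.
  rewrite -natr1 in n2 dlen len.
  have ts0 : 0 <= t - s by rewrite subr_ge0.
  have l0d : 0 <= l0 * d by apply: mulr_ge0 => //; exact: ltW.
  have lam'0 : 0 <= lam' by lra.
  split.
  - apply: le_trans (_ : L * l0 * (d + (k0 + 1)) <= _).
      apply: le_trans n2 _; rewrite mulrDl mul1r.
      have -> : L * l0 * (d + (k0 + 1)) = l0 * (d + k0) * L + L * l0 by ring.
      by apply: lerD => //; rewrite ler_peMr//; exact: le_trans L1.
    by apply: ler_pM; rewrite /lam' /kap'; const_lra.
  - have : M * (t - s) <= lam' * (t - s).
      by apply: ler_wpM2r => //; rewrite /lam'; lra.
    by rewrite /kap'; move: dlen nM'; rewrite mulrDl; const_lra.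
  - apply: length_le_mono len.
    have : l0 * M * d <= improved_k1 lam' kap' * d.
      apply: ler_wpM2r => //; rewrite /improved_k1.
      apply: le_trans (_ : 1 * (l0 * M) <= _); first by rewrite mul1r.
      by apply: ler_pM; rewrite // /kap'; const_lra.
    have : 3 * kap' <= improved_k2 lam' kap'.
      rewrite /improved_k2; apply: ler_pM => //; last by lra.
      by rewrite lerDr; apply: mulr_ge0; lra.
    move: (improved_k1 _ _) (improved_k2 _ _) => k1 k2; rewrite /kap' => ? ?.
    have := k00; lra.
have lam'gt0 : 0 < lam' by lra.
split=> //.
- move=> s t sI tI; wlog st : s t sI tI / s <= t.
    move=> wlog; have [st|/ltW ts] := leP s t; first exact: wlog.
    by rewrite distrC metric_sym; exact: wlog.
  have [m1 m2 _] := main s t sI tI st.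
  rewrite distrC ger0_norm ?subr_ge0// m2 andbT.
  by rewrite lerBlDr ler_pdivrMl.
- move=> s t sI tI st; apply/arc_length_leP => //.
  by have [] := main s t sI tI st.
Qed.

End LocalToGlobal.

Theorem theorem1p2 (R : realType) (X : metricType R)
    (lambda0 kappa0 : R) (T : X -> X -> R) (cq : X -> X -> R -> X)
    (hX : geodesic_space X)
    (hlambda0 : 1 <= lambda0) (hkappa0 : 0 <= kappa0)
    (hcombing : quasi_geodesic_combing lambda0 kappa0 T cq)
    (hbounded : bounded_combing kappa0 cq) :
  forall lambda kappa mu : R, 1 <= lambda -> 0 <= kappa -> 0 <= mu ->
  exists D lambda' kappa' : R,
    [/\ 0 <= D, 1 <= lambda', 0 <= kappa' &
      forall (I : interval R) (p : R -> X), is_path I p ->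
        locally_on D
          (fun J g => quasi_geodesic lambda kappa J g /\
             weakly_morse (2 * lambda0 + 2) kappa0 mu J g) I p ->
        quasi_geodesic lambda' kappa' I p].
Proof.
move=> lambda kappa mu lambda1 kappa_ge0 mu_ge0.
exact: local_to_global hX hlambda0 hkappa0 hcombing hbounded _ _ _ lambda1
  kappa_ge0 mu_ge0.
Qed.
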